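(* Let $\mu\ge 3$ be an integer, let $\mathfrak{t}_\mu$ be the Hecke triangle group generated by $Tz=z+\varpi_\mu$, $\varpi_\mu=2\cos(\pi/\mu)$, and $Sz=-1/z$, and let $U=U_{\mathfrak{t}_\mu,w,r}$ be a quasiautomorphic form of weight $w$ and depth $r$ ($0\le r\le w/2$) with respect to $\mathfrak{t}_\mu$. Let $\mathbf{F}_U$ be the Hecke vector-form of $U$ and let $A_r$ be the $(r+1)\times(r+1)$ creation matrix. Then for $z\in\mathbb{H}$, $$\mathbf{F}_U(Tz)=e^{\varpi_\mu A_r}\,\mathbf{F}_U(z).$$
   Context: $\mathbb{H}$ is the upper half-plane. $\mathcal{A}_k(\mathfrak{t}_\mu)$ is the vector space of automorphic forms of weight $k$ with respect to $\mathfrak{t}_\mu$: functions $H$ holomorphic on $\mathbb{H}$ and at the cusp $i\infty$ with $H(Tz)=H(z)$ and $H(Sz)=z^kH(z)$. $E_2=E_{\mathfrak{t}_\mu,2}$ is the weight $2$ (quasiautomorphic) Eisenstein series for $\mathfrak{t}_\mu$, which is holomorphic on $\mathbb{H}$ and periodic under $T$. $C=C_{\mathfrak{t}_\mu}$ is the unique structure constant associated to $E_2$, i.e. $\lim_{z\to i\infty}E_2(z)=C$. A quasiautomorphic form of weight $w$ ($w\ge 2$ an even integer) and depth $r$ (an integer with $0\le r\le w/2$) is a function $U(z)=\sum_{k=0}^r H_{w-2k}(z)E_2(z)^k$ with $H_{w-2k}\in\mathcal{A}_{w-2k}(\mathfrak{t}_\mu)$. Write $B_{U,k}:=H_{w-2k}$.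 For $0\le \ell\le r$ and $m\ge 0$ put $\{r,\ell\}_m:=\frac{(m+\ell)!\,(r-\ell)!}{m!\,r!}$, and define $$g_\ell(z):=C^\ell\sum_{m=0}^{r-\ell}\{r,\ell\}_m\,B_{U,\ell+m}(z)\,E_2(z)^m\quad(0\le\ell\le r),\qquad f_n(z):=\sum_{k=0}^n\binom{n}{k}g_k(z)\,z^{n-k}\quad(0\le n\le r).$$ The Hecke vector-form of $U$ is the column vector $\mathbf{F}_U(z):=(f_0(z),f_1(z),\dots,f_r(z))^{\mathbf t}$. The creation matrix $A_r$ is the $(r+1)\times(r+1)$ matrix, rows and columns indexed by $0,\dots,r$, whose $(i,i-1)$ entry is $i$ for $1\le i\le r$ and whose other entries are $0$. $e^M=\sum_{n\ge 0}M^n/n!$ is the matrix exponential. *)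

(* Defs.v *)
From mathcomp Require Import all_boot all_order all_algebra.
From mathcomp Require Import all_classical all_reals all_analysis.
From mathcomp Require Import complex.

Set Implicit Arguments.
Unset Strict Implicit.
Unset Printing Implicit Defensive.

Import Order.TTheory GRing.Theory Num.Theory.
Import numFieldNormedType.Exports.

Local Open Scope classical_set_scope.
Local Open Scope ring_scope.
Local Open Scope complex_scope.

Definition holomorphic_on (K : numFieldType) (D : set K) (H : K -> K) : Prop :=
  forall z, D z -> derivable H z 1.

Definition expmx (K : numFieldType) n (M : 'M[K]_n.+1) : 'M[K]_n.+1 :=
  lim (series (fun k => k`!%:R^-1 *: M ^+ k) @ \oo).

Section HeckeVectorForms.
Context {R : realType}.
Implicit Types (mu k l m n r w : nat) (z C : R[i]) (H U : R[i] -> R[i])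
  (B : nat -> R[i] -> R[i]).

Definition upper_half_plane : set R[i] := [set z | 0 < complex.Im z].

Definition cexp z : R[i] :=
  (expR (complex.Re z))%:C *
    (cos (complex.Im z) +i* sin (complex.Im z)).

(* the translation length 2 cos(pi / mu) of T, as a complex number *)
Definition cusp_width mu : R[i] := (2 * cos (pi / mu%:R))%:C.

Definition hecke_T mu z : R[i] := z + cusp_width mu.
Definition hecke_S z : R[i] := - z^-1.

(* the neighbourhoods of i oo are the sets containing some {Im z > M} *)
Definition cusp_nbhs : set_system R[i] :=
  filter_from [set: R] (fun M => [set z | M < complex.Im z]).

Definition cusp_param mu z : R[i] :=
  cexp (2 * pi%:C * 'i%C * z / cusp_width mu).

(* H extends holomorphically to q = 0 as a function of
   q = exp (2 pi i z / (2 cos (pi / mu))) *)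
Definition holomorphic_at_cusp mu H : Prop :=
  exists2 h : R[i] -> R[i],
    holomorphic_on [set q | `|q| < 1] h &
    forall z, upper_half_plane z -> H z = h (cusp_param mu z).

Definition automorphic_form mu k H : Prop :=
  [/\ holomorphic_on upper_half_plane H,
      holomorphic_at_cusp mu H,
      forall z, upper_half_plane z -> H (hecke_T mu z) = H z &
      forall z, upper_half_plane z -> H (hecke_S z) = z ^+ k * H z].

(* The weight 2 quasiautomorphic Eisenstein series, with C its limit at i oo.
   There is no nonzero automorphic form of weight 2, so these conditions
   determine E2 up to a nonzero scalar; all normalisations are admitted. The
   condition kappa != 0 is what makes E2 nonzero, and makes it algebraically
   independent of the automorphic forms. The alias R[i]^o carries the normed
   topology of R[i]. *)
Definition eisenstein2 mu (E2 : R[i] -> R[i]) C : Prop :=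
  [/\ holomorphic_on upper_half_plane E2,
      forall z, upper_half_plane z -> E2 (hecke_T mu z) = E2 z,
      exists2 kappa : R[i], kappa != 0 &
        forall z, upper_half_plane z ->
          E2 (hecke_S z) = z ^+ 2 * E2 z + kappa * z &
      (E2 : R[i] -> R[i]^o) @ cusp_nbhs --> (C : R[i]^o)].

(* U is quasiautomorphic of weight w and depth r with components B; the family
   B 0, ..., B r is determined by U on the upper half-plane, and B k for k > r
   is irrelevant. *)
Definition quasiautomorphic_form mu (E2 : R[i] -> R[i]) w r U B : Prop :=
  (forall k, (k <= r)%N -> automorphic_form mu (w - 2 * k) (B k)) /\
  (forall z, upper_half_plane z -> U z = \sum_(0 <= k < r.+1) B k z * E2 z ^+ k).

Definition hecke_coef r l m : R[i] :=
  ((m + l)`! * (r - l)`!)%:R / (m`! * r`!)%:R.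

Definition hecke_g (E2 : R[i] -> R[i]) C r B l z : R[i] :=
  C ^+ l * \sum_(0 <= m < (r - l).+1) hecke_coef r l m * B (l + m)%N z * E2 z ^+ m.

Definition hecke_f (E2 : R[i] -> R[i]) C r B n z : R[i] :=
  \sum_(0 <= k < n.+1) 'C(n, k)%:R * hecke_g E2 C r B k z * z ^+ (n - k).

Definition hecke_vector_form (E2 : R[i] -> R[i]) C r B z :
    'cV[R[i]]_r.+1 :=
  \col_(n < r.+1) hecke_f E2 C r B n z.

Definition creation_mx r : 'M[R[i]]_r.+1 :=
  \matrix_(i, j) (if i == j.+1 :> nat then (i : nat)%:R else 0).

End HeckeVectorForms.

(* Main.v *)
(** Every coefficient [g_k] is invariant under [T], so [f_n (T z)] is
    [\sum_k 'C(n, k) g_k(z) (z + a)^(n - k)] with [a] the width of the cusp.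
    Since [A_r] is nilpotent, [e^(a A_r)] is a finite sum, with [(i, j)] entry
    ['C(i, j) a^(i - j)]; the claim is then the binomial theorem applied to
    [(z + a)^(n - k)], via ['C(n, j) 'C(j, k) = 'C(n, k) 'C(n - k, j - k)]. *)

Require Import Defs.
From mathcomp Require Import all_boot all_order all_algebra.
From mathcomp Require Import all_classical all_reals all_analysis.
From mathcomp Require Import complex.
From mathcomp Require Import zify ring.

Import Order.TTheory GRing.Theory Num.Theory.
Import numFieldNormedType.Exports.

Local Open Scope ring_scope.
Local Open Scope complex_scope.

(** The partial sums are constant from index [m] on, so they converge to that constant, and limits
    are unique in a normed space. *)
Lemma expmx_nilpotent (K : numFieldType) n (M : 'M[K]_n.+1) m :
  M ^+ m = 0 -> expmx M = \sum_(0 <= k < m) k`!%:R^-1 *: M ^+ k.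
Proof.
move=> Mm0; apply: cvg_lim; first exact: norm_hausdorff.
apply: cvg_near_cst; exists m => // p /= lemp.
rewrite /series /= (big_cat_nat _ lemp) //= [X in _ + X]big_nat.
rewrite [X in _ + X]big1 ?addr0 //.
by move=> k /andP[lemk _]; rewrite -(subnK lemk) exprD Mm0 mulr0 scaler0.
Qed.

(** Each factor moves the nonzero entries one subdiagonal down and multiplies by the row index, so
    falling factorials accumulate. *)
Lemma creation_mxX (R : realType) r k (i j : 'I_r.+1) :
  (@creation_mx R r ^+ k) i j =
  if i == (j + k)%N :> nat then (i ^_ k)%:R else 0.
Proof.
elim: k i => [|k IHk] i.
  by rewrite expr0 mxE addn0 ffactn0 -val_eqE; case: eqP.
rewrite exprS mxE; case: eqP => [eq_i|ne_i].
  have lt_l : (j + k < r.+1)%N by have := ltn_ord i; lia.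
  (* Row [i] of the left factor only sees [l = i - 1 = j + k], and
     [i * (i - 1) ^_ k = i ^_ k.+1]. *)
  rewrite (bigD1 (Ordinal lt_l)) //= big1 => [|l ne_l].
    by rewrite IHk mxE /= eqxx eq_i addnS eqxx addr0 -natrM ffactSS.
  rewrite mxE; case: eqP => [eq_il|]; rewrite ?mul0r //.
  by case/eqP: ne_l; apply: val_inj => /=; lia.
rewrite big1 // => l _; rewrite IHk mxE.
case: eqP => [eq_il|]; rewrite ?mul0r //.
by case: eqP => [eq_lj|]; rewrite ?mulr0 //; lia.
Qed.

Lemma expmx_creation (R : realType) r (a : R[i]) (i j : 'I_r.+1) :
  expmx (a *: creation_mx r) i j = 'C(i, j)%:R * a ^+ (i - j).
Proof.
have powE k : (a *: creation_mx r) ^+ k = a ^+ k *: @creation_mx R r ^+ k.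
  by rewrite exprZn.
(* The power [r.+1] vanishes because [p = q + r.+1] is impossible for [p <= r]. *)
rewrite (@expmx_nilpotent _ _ _ r.+1); last first.
  apply/matrixP => p q; rewrite powE !mxE creation_mxX.
  by case: eqP => [|_]; [have := ltn_ord p; lia | rewrite mulr0].
rewrite big_mkord summxE.
under eq_bigr => k _ do rewrite powE !mxE creation_mxX.
have [le_ji|lt_ij] := leqP j i; last first.
  rewrite bin_small // mul0r big1 // => k _.
  by case: eqP => [|_]; [lia | rewrite !mulr0].
have lt_ij : (i - j < r.+1)%N by have := ltn_ord i; lia.
(* Only the term [k = i - j] survives; dividing [i ^_ (i - j)] by [(i - j)!] leaves
   ['C(i, i - j) = 'C(i, j)]. *)
rewrite (bigD1 (Ordinal lt_ij)) //= subnKC // eqxx big1 => [|k ne_k].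
  rewrite addr0 -bin_ffact bin_sub // natrM mulrCA.
  have : (i - j)`!%:R != 0 :> R[i] by rewrite pnatr_eq0 -lt0n fact_gt0.
  by move=> nz; field.
case: eqP => [eq_i|_]; rewrite ?mulr0 //.
by case/eqP: ne_k; apply: val_inj => /=; lia.
Qed.

(** Both sides are the multinomial coefficient [n! / (k! (m - k)! (n - m)!)]; the proof clears this
    denominator. *)
Lemma bin_trinomial n m k :
  (k <= m <= n)%N -> ('C(n, m) * 'C(m, k) = 'C(n, k) * 'C(n - k, m - k))%N.
Proof.
move=> /andP[le_km le_mn].
apply/eqP; rewrite -(eqn_pmul2r (fact_gt0 k)) -(eqn_pmul2r (fact_gt0 (m - k))).
rewrite -(eqn_pmul2r (fact_gt0 (n - m))); apply/eqP.
have := bin_fact le_mn; have := bin_fact le_km.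
have := bin_fact (leq_trans le_km le_mn).
have : (m - k <= n - k)%N by lia.
move=> /bin_fact; have -> : (n - k - (m - k) = n - m)%N by lia.
nia.
Qed.

Lemma binomial_transform_shift (K : comNzRingType) (g : nat -> K) (a z : K) n :
  \sum_(k < n.+1) 'C(n, k)%:R * g k * (z + a) ^+ (n - k) =
  \sum_(j < n.+1) 'C(n, j)%:R * a ^+ (n - j) *
    \sum_(k < j.+1) 'C(j, k)%:R * g k * z ^+ (j - k).
Proof.
have -> : \sum_(j < n.+1) 'C(n, j)%:R * a ^+ (n - j) *
      (\sum_(k < j.+1) 'C(j, k)%:R * g k * z ^+ (j - k)) =
    \sum_(j < n.+1) \sum_(k < n.+1 | (k <= j)%N)
      'C(n, j)%:R * a ^+ (n - j) * ('C(j, k)%:R * g k * z ^+ (j - k)).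
  apply: eq_bigr => j _; rewrite mulr_sumr.
  by rewrite (big_ord_widen _ (fun k => 'C(n, j)%:R * a ^+ (n - j) *
    ('C(j, k)%:R * g k * z ^+ (j - k))) (ltn_ord j)).
rewrite (exchange_big_dep xpredT) //=; apply: eq_bigr => k _.
(* With [a] first, the expansion carries [a ^+ (n - k - l) * z ^+ l], which matches the right-hand
   side under [j = l + k]. *)
rewrite addrC exprDn_comm; last exact: mulrC.
rewrite mulr_sumr.
rewrite -(big_mkord xpredT (fun l => 'C(n, k)%:R * g k *
  (a ^+ (n - k - l) * z ^+ l *+ 'C(n - k, l)))).
rewrite -(big_mkord (fun j => k <= j)%N (fun j => 'C(n, j)%:R * a ^+ (n - j) *
  ('C(j, k)%:R * g k * z ^+ (j - k)))).
have le_kn : (k <= n)%N by rewrite -ltnS.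
rewrite [RHS](big_cat_nat (n := k)) //=; last by lia.
rewrite [X in _ = X + _]big_nat_cond.
rewrite [X in _ = X + _]big1 ?add0r => [|j lt_jk]; last by exfalso; lia.
rewrite -[X in index_iota X n.+1]add0n [RHS]big_addn -subSn //.
rewrite [RHS]big_mkcond /=; apply: eq_big_nat => l lt_l.
rewrite leq_addl addnK -mulr_natr.
have -> : (n - (l + k) = n - k - l)%N by lia.
have /(congr1 (fun x => x%:R : K)) :
    ('C(n, l + k) * 'C(l + k, k) = 'C(n, k) * 'C(n - k, l))%N.
  by rewrite bin_trinomial ?addnK //; lia.
rewrite !natrM => E.
transitivity ('C(n, k)%:R * 'C(n - k, l)%:R *
  (g k * a ^+ (n - k - l) * z ^+ l)).
  by ring.
by rewrite -E; ring.
Qed.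

Theorem theorem1 (R : realType) (mu : nat) (hmu : (3 <= mu)%N)
    (E2 : R[i] -> R[i]) (C : R[i]) (hE2 : eisenstein2 mu E2 C)
    (w r : nat) (hw2 : (2 <= w)%N) (hw : ~~ odd w) (hr : (r <= w./2)%N)
    (U : R[i] -> R[i]) (B : nat -> R[i] -> R[i])
    (hU : quasiautomorphic_form mu E2 w r U B)
    (z : R[i]) (hz : upper_half_plane z) :
  hecke_vector_form E2 C r B (hecke_T mu z) =
  expmx (cusp_width mu *: creation_mx r) *m hecke_vector_form E2 C r B z.
Proof.
have [_ E2T _ _] := hE2; have [autB _] := hU.
have gT k : (k <= r)%N ->
    hecke_g E2 C r B k (hecke_T mu z) = hecke_g E2 C r B k z.
  move=> le_kr; congr (_ * _); apply: eq_big_nat => m lt_m.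
  (* The sum stops at [m = r - k], so only components of index at most [r] occur. *)
  have [|_ _ BT _] := autB (k + m)%N; first by lia.
  by rewrite E2T // BT.
apply/colP => n; rewrite !mxE.
under [RHS]eq_bigr => j _ do rewrite expmx_creation mxE /hecke_f big_mkord.
rewrite /hecke_f big_mkord.
have le_nr : (n <= r)%N by rewrite -ltnS.
under [LHS]eq_bigr => k _ do rewrite gT ?(leq_trans _ le_nr) ?leq_ord //.
rewrite (binomial_transform_shift _ (fun k => hecke_g E2 C r B k z)).
(* The matrix product runs over all [j <= r], the shift identity only over [j <= n]; the extra terms
   vanish since ['C(n, j) = 0] for [j > n]. *)
pose F j := 'C(n, j)%:R * cusp_width mu ^+ (n - j) *
  \sum_(k < j.+1) 'C(j, k)%:R * hecke_g E2 C r B k z * z ^+ (j - k).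
rewrite (big_ord_widen r.+1 F) // big_mkcond; apply: eq_bigr => j _ /=.
by case: ltnP => // lt_nj; rewrite bin_small // !mul0r.
Qed.
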